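(* Let $G$ be a finite simple graph on $n$ vertices with $\alpha(G)\le 2$ that contains no induced subgraph isomorphic to the house graph. Then $G$ contains $K_{\lceil n/2\rceil}$ as an immersion.
   Context: $\alpha(G)$ is the independence number. The house graph is the 5-vertex graph consisting of a 4-cycle $a,b,c,d$ (edges $ab,bc,cd,da$) together with a fifth vertex $e$ adjacent exactly to $a$ and $b$ (equivalently, the complement of the path $P_5$). A graph $G$ contains a graph $K$ as an immersion if there is an injective map $\phi\colon V(K)\to V(G)$ such that for every edge $uv\in E(K)$ there is a path $P_{uv}$ in $G$ with endpoints $\phi(u),\phi(v)$, the paths $P_{uv}$ are pairwise edge-disjoint, and no vertex of $\phi(V(K))$ is an interior vertex of any path $P_{uv}$. *)

(* Defs.v *)
From mathcomp Require Import all_boot.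

Set Implicit Arguments.
Unset Strict Implicit.
Unset Printing Implicit Defensive.

Record sgraph := SGraph {
  vertex :> finType;
  edge : rel vertex;
  edge_sym : symmetric edge;
  edge_irr : irreflexive edge
}.

Arguments edge {s} x y.

Section Notions.
Variable G : sgraph.

Definition edges : {set {set G}} :=
  [set [set p.1; p.2] | p in [pred p : G * G | edge p.1 p.2]].

Definition stable (S : {set G}) : bool :=
  [forall x in S, forall y in S, ~~ edge x y].

Definition alpha : nat := \max_(S : {set G} | stable S) #|S|.

Definition induced_edge (S : {set G}) : rel {x : G | x \in S} :=
  fun x y => edge (val x) (val y).

Lemma induced_sym (S : {set G}) : symmetric (@induced_edge S).
Proof. by move=> x y; apply: edge_sym. Qed.

Lemma induced_irr (S : {set G}) : irreflexive (@induced_edge S).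
Proof. by move=> x; apply: edge_irr. Qed.

Definition induced (S : {set G}) : sgraph :=
  SGraph (@induced_sym S) (@induced_irr S).

(* A path is the sequence of all its vertices, both ends included. *)
Definition path_between (x y : G) (s : seq G) : Prop :=
  exists p : seq G, [/\ s = x :: p, path edge x p, last x p = y & uniq s].

Definition path_edges (s : seq G) : {set {set G}} :=
  [set:: [seq [set p.1; p.2] | p <- zip s (behead s)]].

Definition interior (s : seq G) : seq G := behead (take (size s).-1 s).

End Notions.

Definition isomorphic (G H : sgraph) : Prop :=
  exists2 f : G -> H, bijective f & forall x y : G, edge (f x) (f y) = edge x y.

Definition contains_induced (G H : sgraph) : Prop :=
  exists S : {set G}, isomorphic (induced S) H.

(* The paths are indexed by the edges of K as unordered pairs, so that the two
   orientations of an edge share one path, listed from either of its ends. *)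
Definition contains_immersion (G K : sgraph) : Prop :=
  exists (phi : K -> G) (P : {set K} -> seq G),
    [/\ injective phi,
        forall u v : K, edge u v ->
          path_between (phi u) (phi v) (P [set u; v]) \/
          path_between (phi v) (phi u) (P [set u; v]),
        forall A B : {set K}, A \in edges K -> B \in edges K -> A != B ->
          [disjoint path_edges (P A) & path_edges (P B)]
      & forall (A : {set K}) (w : K), A \in edges K ->
          phi w \notin interior (P A)].

Definition complete_edge (m : nat) : rel 'I_m := fun x y => x != y.

Lemma complete_sym m : symmetric (@complete_edge m).
Proof. by move=> x y; rewrite /complete_edge eq_sym. Qed.

Lemma complete_irr m : irreflexive (@complete_edge m).
Proof. by move=> x; rewrite /complete_edge eqxx. Qed.

Definition complete (m : nat) : sgraph :=
  SGraph (@complete_sym m) (@complete_irr m).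

(* Vertices a, b, c, d, e are numbered 0, 1, 2, 3, 4. *)
Definition house_edges : seq (nat * nat) :=
  [:: (0, 1); (1, 2); (2, 3); (3, 0); (4, 0); (4, 1)].

Definition house_edge : rel 'I_5 :=
  fun x y => ((x : nat, y : nat) \in house_edges) ||
             ((y : nat, x : nat) \in house_edges).

Lemma house_sym : symmetric house_edge.
Proof. by move=> x y; rewrite /house_edge orbC. Qed.

Lemma house_irr : irreflexive house_edge.
Proof. by case=> [[|[|[|[|[|?]]]]] ?]. Qed.

Definition house : sgraph := SGraph house_sym house_irr.

(* Main.v *)
(** Let [H] be the complement of [G]: it has no triangle and no induced path on
    five vertices.  If [B] is a set of vertices and [m] an injection of [B] into
    its complement such that every [H]-edge [x y] of [B] makes [x - m y],
    [m y - m x] and [m x - y] edges of [G], then the paths [x, m y, m x, y],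
    together with the edges of [G] inside [B], immerse the complete graph on
    [B]; so it suffices to find such a [B] with at least half of the vertices.
    Vertices in different components of [H] are adjacent in [G], hence the
    components can be treated one at a time.  A bipartite component is handled
    by its larger side.  Otherwise the component contains a pentagon
    [c0 c1 c2 c3 c4] and is covered by the classes [Wi] of common neighbours of
    [c(i-1)] and [c(i+1)].  After a rotation, [#|W1| <= #|W0|] and
    [#|W2| <= #|W3|]; one of [W0 + W3], which is stable in [H], and
    [W1 + W2 + W4], with mates of [W1] in [W0] and of [W2] in [W3], contains
    half of the component. *)

Require Import Defs.
From mathcomp Require Import all_boot.
From mathcomp Require Import zify.

Set Implicit Arguments.
Unset Strict Implicit.
Unset Printing Implicit Defensive.

(** * Preliminaries on finite sets *)

Lemma exists_injection_in (T : finType) (A B : {set T}) :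
  #|A| <= #|B| ->
  exists f : T -> T, {in A, forall x, f x \in B} /\ {in A &, injective f}.
Proof.
move=> leAB; exists (fun x => nth x (enum B) (index x (enum A))).
have lt_idx x : x \in A -> index x (enum A) < size (enum B).
  by move=> xA; rewrite -cardE (leq_trans _ leAB) // cardE index_mem mem_enum.
split=> [x xA|x y xA yA]; first by rewrite -mem_enum mem_nth // lt_idx.
(* The default value of [nth] varies with the point; as indices of members of [A] are in range, both
   sides may be given the same one. *)
rewrite (set_nth_default y) ?lt_idx // => /eqP.
rewrite nth_uniq ?lt_idx ?enum_uniq // => /eqP idx_eq.
by rewrite -(nth_index x (_ : x \in enum A)) ?mem_enum // idx_eq nth_index ?mem_enum.
Qed.

Lemma set2_eq (T : finType) (a b c d : T) :
  [set a; b] = [set c; d] -> a = c /\ b = d \/ a = d /\ b = c.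
Proof.
move=> E; move: (set21 a b) (set22 a b) (set21 c d) (set22 c d).
rewrite {1 2}E -{3 4}E !inE.
by do 4![case/orP=> /eqP ?]; subst; auto.
Qed.

(** * Mated sets in a triangle-free graph *)

Section Mates.

Variables (V : finType) (h : rel V).

(* [h] is the complement relation, so [~~ h] means equal or adjacent in the
   graph; only the vertices of [B] with an [h]-neighbour in [B] need a mate. *)
Definition mated (S B : {set V}) (m : V -> V) : Prop :=
  [/\ B \subset S,
      forall x y, x \in B -> y \in B -> h x y ->
        [/\ m x \in S :\: B, ~~ h x (m y) & ~~ h (m x) (m y)]
    & forall x y x' y', x \in B -> y \in B -> x' \in B -> y' \in B ->
        h x y -> h x' y' -> m x = m x' -> x = x'].

Definition half_mated (S : {set V}) : Prop :=
  exists B m, mated S B m /\ #|S| <= 2 * #|B|.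

(** Without [h]-edges inside [B] the mate conditions are vacuous. *)
Lemma half_mated_stable (S B : {set V}) :
  B \subset S -> {in B &, forall x y, ~~ h x y} -> #|S| <= 2 * #|B| ->
  half_mated S.
Proof.
move=> sBS stB leSB; exists B, id; split=> //.
split=> // x y xB yB hxy.
by rewrite (negPf (stB _ _ xB yB)) in hxy.
Qed.

Hypothesis h_sym : symmetric h.

(** Mates stay on their own side of the partition of [S], so the two mate maps glue without
    collisions. *)
Lemma half_mated_join (S U : {set V}) :
  U \subset S -> {in U & S :\: U, forall x y, ~~ h x y} ->
  half_mated U -> half_mated (S :\: U) -> half_mated S.
Proof.
move=> sUS sep [B [m [[sB mB injB] leB]]] [C [k [[sC mC injC] leC]]].
have BU x : x \in B -> x \in U by apply/subsetP.
have CU x : x \in C -> x \in S :\: U by apply/subsetP.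
have hBC x y : x \in B -> y \in C -> h x y = false.
  by move=> xB yC; apply/negbTE/sep; [apply: BU | apply: CU].
have hCB x y : x \in C -> y \in B -> h x y = false.
  by move=> xB yC; rewrite h_sym hBC.
have CnU x : x \in C -> (x \in U) = false.
  by move=> /CU; rewrite inE => /andP[/negbTE].
have CnB x : x \in C -> (x \in B) = false.
  by move=> xC; apply/negP=> /BU; rewrite CnU.
exists (B :|: C), (fun x => if x \in U then m x else k x); split; last first.
  rewrite cardsU disjoint_setI0 ?cards0 ?subn0; last first.
    by rewrite disjoint_sym disjoint_subset; apply/subsetP=> x xC; rewrite inE CnB.
  by have := cardsID U S; rewrite (setIidPr sUS) => <-; rewrite mulnDr leq_add.
split.
- rewrite subUset (subset_trans sB sUS) (subset_trans sC) // subsetDl //.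
- move=> x y; rewrite !inE => /orP[] xBC /orP[] yBC hxy.
  + rewrite !BU //; have [mx nx nm] := mB _ _ xBC yBC hxy; split=> //.
    move: mx; rewrite inE => /andP[/negbTE-> mxU].
    rewrite (subsetP sUS) // andbT orFb.
    by apply/negP=> /CU; rewrite inE mxU.
  + by rewrite hBC in hxy.
  + by rewrite hCB in hxy.
  + rewrite !CnU //; have [mx nx nm] := mC _ _ xBC yBC hxy; split=> //.
    move: mx; rewrite !inE => /and3P[/negbTE-> nU ->].
    by rewrite orbF andbT; apply: contra nU; apply: BU.
- move=> x y x' y'; rewrite !inE => /orP[] xBC /orP[] yBC /orP[] x'BC /orP[] y'BC
    hxy hx'y'; try by [rewrite hBC in hxy | rewrite hCB in hxy
                      | rewrite hBC in hx'y' | rewrite hCB in hx'y'].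
  + by rewrite !BU //; apply: injB hxy hx'y'.
  + rewrite (BU x) // (CnU x') //.
    have [+ _ _] := mB _ _ xBC yBC hxy; have [+ _ _] := mC _ _ x'BC y'BC hx'y'.
    by rewrite !inE => /and3P[_ nU _] /andP[_ mU] E; rewrite -E mU in nU.
  + rewrite (CnU x) // (BU x') //.
    have [+ _ _] := mC _ _ xBC yBC hxy; have [+ _ _] := mB _ _ x'BC y'BC hx'y'.
    by rewrite !inE => /andP[_ mU] /and3P[_ nU _] E; rewrite E mU in nU.
  + by rewrite !CnU //; apply: injC hxy hx'y'.
Qed.

Hypothesis h_triangle_free : forall x y z, h x y -> h y z -> h x z -> False.

(* The chords [a c], [b d] and [c e] would close a triangle. *)
Hypothesis h_P5_free : forall a b c d e,
  h a b -> h b c -> h c d -> h d e -> [|| h a d, h a e | h b e].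

Let tri a b z : h a z -> h b z -> ~~ h a b.
Proof.
move=> haz hbz; apply/negP=> hab.
by apply: (h_triangle_free hab hbz).
Qed.

(** * The classes around a pentagon *)

Section Pentagon.

Variable S : {set V}.

(** For a pentagon [a b c d e], the classes [W0] to [W4] are [twins e b], [twins a c], [twins b d],
    [twins c e] and [twins d a]. The pentagon itself may leave [S]. *)
Definition twins (x y : V) : {set V} := [set z in S | h x z && h y z].

(** Triangle-freeness makes such a closed walk an induced five-cycle. *)
Definition pentagon a b c d e :=
  [&& h a b, h b c, h c d, h d e & h e a].

(** The path [w u b c d] yields an edge from [w] to [c] or [d]; then [a e d c w] or [a b c d w]
    yields the edge [a w]. *)
Lemma twins_closed a b c d e u w :
  pentagon a b c d e -> u \in twins e b -> w \in S -> h u w ->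
  (w \in twins a c) || (w \in twins d a).
Proof.
move=> /and5P[hab hbc hcd hde hea]; rewrite !inE => /and3P[uS heu hbu] wS huw.
rewrite wS /=.
have hwu : h w u by rewrite h_sym.
have hub : h u b by rewrite h_sym.
have hue : h u e by rewrite h_sym.
have hba : h b a by rewrite h_sym.
have hcb : h c b by rewrite h_sym.
have hdc : h d c by rewrite h_sym.
have hed : h e d by rewrite h_sym.
have hae : h a e by rewrite h_sym.
have nwb : ~~ h w b by exact: (tri hwu hbu).
have new : ~~ h e w by exact: (tri heu hwu).
have nbw : ~~ h b w by exact: (tri hbu hwu).
have nac : ~~ h a c by exact: (tri hab hcb).
have nda : ~~ h d a by exact: (tri hde hae).
have nud : ~~ h u d by exact: (tri hue hde).
have := h_P5_free hwu hub hbc hcd.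
rewrite (negPf nud) orbF => /orP[]; rewrite h_sym => hw.
  have := h_P5_free hae hed hdc hw.
  by rewrite (negPf nac) (negPf new) orbF /= => ->; rewrite hw.
have := h_P5_free hab hbc hcd hw.
by rewrite (h_sym a d) (negPf nda) (negPf nbw) orbF /= => ->; rewrite hw orbT.
Qed.

(** The grouping separates the two candidates, [W0 + W3] and [W1 + W2 + W4]. *)
Definition pentagon_hull a b c d e : {set V} :=
  (twins e b :|: twins c e) :|: (twins a c :|: twins b d :|: twins d a).

Lemma pentagon_hull_rot a b c d e :
  pentagon_hull a b c d e = pentagon_hull b c d e a.
Proof.
apply/setP=> x; rewrite !inE; case: (x \in S) => //=.
by case: (h a x); case: (h b x); case: (h c x); case: (h d x); case: (h e x).
Qed.

Lemma pentagon_rot a b c d e : pentagon a b c d e -> pentagon b c d e a.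
Proof. by case/and5P=> *; apply/and5P. Qed.

(** Each class is the [W0] of some rotation, so [twins_closed] applies to it. *)
Lemma pentagon_hull_closed a b c d e u w :
  pentagon a b c d e -> u \in pentagon_hull a b c d e -> w \in S -> h u w ->
  w \in pentagon_hull a b c d e.
Proof.
move=> p0 uH wS huw.
have p1 := pentagon_rot p0; have p2 := pentagon_rot p1.
have p3 := pentagon_rot p2; have p4 := pentagon_rot p3.
have step a' b' c' d' e' : pentagon a' b' c' d' e' -> u \in twins e' b' ->
    w \in pentagon_hull a' b' c' d' e'.
  move=> p uW; have := twins_closed p uW wS huw.
  by rewrite /pentagon_hull !in_setU => /orP[]->; rewrite !orbT.
rewrite !in_setU in uH.
case/orP: uH => [/orP[]|/orP[/orP[]|]] uW.
- exact: step _ _ _ _ _ p0 uW.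
- by move: (step _ _ _ _ _ p3 uW); rewrite -3!pentagon_hull_rot.
- by move: (step _ _ _ _ _ p1 uW); rewrite -pentagon_hull_rot.
- by move: (step _ _ _ _ _ p2 uW); rewrite -2!pentagon_hull_rot.
- by move: (step _ _ _ _ _ p4 uW); rewrite -4!pentagon_hull_rot.
Qed.

Lemma half_mated_pentagon_le a b c d e :
  pentagon a b c d e ->
  #|twins a c| <= #|twins e b| -> #|twins b d| <= #|twins c e| ->
  half_mated (pentagon_hull a b c d e).
Proof.
move=> /and5P[hab hbc hcd hde hea] le1 le2.
rewrite /pentagon_hull; set W1 := twins a c; set W2 := twins b d.
set W0 := twins e b; set W3 := twins c e; set W4 := twins d a.
have W0E x : x \in W0 -> h x e /\ h x b by rewrite !inE !(h_sym x) => /and3P[].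
have W1E x : x \in W1 -> h x a /\ h x c by rewrite !inE !(h_sym x) => /and3P[].
have W2E x : x \in W2 -> h x b /\ h x d by rewrite !inE !(h_sym x) => /and3P[].
have W3E x : x \in W3 -> h x c /\ h x e by rewrite !inE !(h_sym x) => /and3P[].
have W4E x : x \in W4 -> h x d /\ h x a by rewrite !inE !(h_sym x) => /and3P[].
have dis p q x : h p q -> h x p -> h x q -> False.
  by move=> hpq hxp hxq; apply: (h_triangle_free hxp hpq).
set Q := W0 :|: W3; set B := W1 :|: W2 :|: W4.
have [leQB|/ltnW leBQ] := leqP #|Q| #|B|; last first.
  apply: (@half_mated_stable _ Q); first exact: subsetUl.
    move=> x y; rewrite !in_setU => /orP[/W0E[hx _]|/W3E[_ hx]];
    by case/orP=> [/W0E[hy _]|/W3E[_ hy]]; apply: tri hx hy.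
  by rewrite cardsU; lia.
have [f [fW f_inj]] := exists_injection_in le1.
have [g [gW g_inj]] := exists_injection_in le2.
(* The value of [m] on [W4] is irrelevant: by [hB] below, no [h]-edge inside [B] meets [W4]. *)
pose m x := if x \in W1 then f x else g x.
have m1 x : x \in W1 -> m x = f x by rewrite /m => ->.
have m2 x : x \in W2 -> m x = g x.
  by rewrite /m; case: ifP => // /W1E[_ hc] /W2E[hb _]; case: (dis b c x).
(* In every other pair of classes, the members share a neighbour on the pentagon. *)
have hB x y : x \in B -> y \in B -> h x y ->
    (x \in W1 /\ y \in W2) \/ (x \in W2 /\ y \in W1).
  rewrite !in_setU => /orP[/orP[]|] xW /orP[/orP[]|] yW hxy; auto;
    exfalso; move: hxy; apply/negP.
  + case: (W1E _ xW) (W1E _ yW) => hx _ [hy _]; exact: tri hx hy.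
  + case: (W1E _ xW) (W4E _ yW) => hx _ [_ hy]; exact: tri hx hy.
  + case: (W2E _ xW) (W2E _ yW) => hx _ [hy _]; exact: tri hx hy.
  + case: (W2E _ xW) (W4E _ yW) => _ hx [hy _]; exact: tri hx hy.
  + case: (W4E _ xW) (W1E _ yW) => _ hx [hy _]; exact: tri hx hy.
  + case: (W4E _ xW) (W2E _ yW) => hx _ [_ hy]; exact: tri hx hy.
  + case: (W4E _ xW) (W4E _ yW) => hx _ [hy _]; exact: tri hx hy.
(* A vertex in both would form a triangle with an edge of the pentagon. *)
have QnB x : x \in Q -> x \notin B.
  rewrite !in_setU => /orP[/W0E|/W3E] [h1 h2]; rewrite -orbA; apply/or3P.
    case=> [/W1E|/W2E|/W4E] [h3 h4].
    - exact: dis hab h3 h2.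
    - exact: dis hde h4 h1.
    - exact: dis hab h4 h2.
  case=> [/W1E|/W2E|/W4E] [h3 h4].
  - exact: dis hea h2 h3.
  - exact: dis hbc h3 h1.
  - exact: dis hcd h1 h3.
have mQ x : x \in W1 \/ x \in W2 -> m x \in Q.
  case=> xW; first by rewrite m1 // in_setU fW.
  by rewrite m2 // in_setU gW // orbT.
exists B, m; split; last by rewrite cardsU; lia.
split; first exact: subsetUr.
  move=> x y xB yB hxy; split.
  - have mxQ : m x \in Q by apply: mQ; case: (hB _ _ xB yB hxy) => -[]; auto.
    by rewrite in_setD QnB //= in_setU mxQ.
  (* The common neighbours are [c] for [W1] and [W3], [b] for [W2] and [W0], and [e] for [W0] and
     [W3]. *)
  - case: (hB _ _ xB yB hxy) => -[xW yW].
      rewrite (m2 y) //.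
      case: (W1E _ xW) (W3E _ (gW _ yW)) => _ hx [hy _]; exact: tri hx hy.
    rewrite (m1 y) //.
    case: (W2E _ xW) (W0E _ (fW _ yW)) => hx _ [_ hy]; exact: tri hx hy.
  - case: (hB _ _ xB yB hxy) => -[xW yW].
      rewrite (m1 x) // (m2 y) //.
      case: (W0E _ (fW _ xW)) (W3E _ (gW _ yW)) => hx _ [_ hy]; exact: tri hx hy.
    rewrite (m2 x) // (m1 y) //.
    case: (W3E _ (gW _ xW)) (W0E _ (fW _ yW)) => _ hx [hy _]; exact: tri hx hy.
have W03 x : x \in W0 -> x \in W3 -> False.
  by move=> /W0E[_ hb] /W3E[hc _]; apply: dis hbc hb hc.
move=> x y x' y' xB yB x'B y'B hxy hx'y'.
have: x \in W1 \/ x \in W2 by case: (hB _ _ xB yB hxy) => -[]; auto.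
have: x' \in W1 \/ x' \in W2 by case: (hB _ _ x'B y'B hx'y') => -[]; auto.
case=> x'W [] xW.
- by rewrite !m1 //; apply: f_inj.
- rewrite (m2 x) // (m1 x') // => E.
  by case: (@W03 (g x)); [rewrite E fW | rewrite gW].
- rewrite (m1 x) // (m2 x') // => E.
  by case: (@W03 (f x)); [rewrite fW | rewrite E gW].
- by rewrite !m2 //; apply: g_inj.
Qed.

(* If no rotation met the two inequalities required above, the class sizes would
   be strictly monotone all the way round the pentagon. *)
Lemma half_mated_pentagon a b c d e :
  pentagon a b c d e -> half_mated (pentagon_hull a b c d e).
Proof.
move=> p0; have p1 := pentagon_rot p0; have p2 := pentagon_rot p1.
have p3 := pentagon_rot p2; have p4 := pentagon_rot p3.
have := half_mated_pentagon_le p0; have := half_mated_pentagon_le p1.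
have := half_mated_pentagon_le p2; have := half_mated_pentagon_le p3.
have := half_mated_pentagon_le p4.
rewrite -(pentagon_hull_rot d) -(pentagon_hull_rot c) -(pentagon_hull_rot b).
rewrite -(pentagon_hull_rot a).
set n0 := #|twins e b|; set n1 := #|twins a c|; set n2 := #|twins b d|.
set n3 := #|twins c e|; set n4 := #|twins d a|.
set P := half_mated _ => q4 q3 q2 q1 q0.
(* If every rotation fails, a weak descent forces another one two places on. As two generates the
   integers modulo five, either all steps are weak descents and the sizes agree, or all are strict
   ascents, which is absurd. *)
have [l0|l0] := leqP n1 n0; have [l1|l1] := leqP n2 n1;
have [l2|l2] := leqP n3 n2; have [l3|l3] := leqP n4 n3;
have [l4|l4] := leqP n0 n4; first [by auto using ltnW | by apply: q0; lia].
Qed.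

End Pentagon.

(** * Breadth-first levels and the induction *)

(* The breadth-first levels of a vertex: level four is empty by P5-freeness,
   and without pentagons the levels of equal parity form a stable set. *)
Lemma half_mated_levels (S : {set V}) (v : V) :
  v \in S -> (forall a b c d, ~~ pentagon v a b c d) ->
  exists U : {set V}, [/\ v \in U, U \subset S,
    {in U & S :\: U, forall x y, ~~ h x y} & half_mated U].
Proof.
move=> vS noC5.
(* [X] collects levels zero and two, [Y] levels one and three. *)
pose N1 := [set x in S | h v x].
pose X := v |: [set x in S | [exists p in N1, h p x]].
pose N3 := [set x in S :\: (X :|: N1) | [exists p in X, h p x]].
pose Y := N1 :|: N3.
have N1P x : x \in N1 -> x \in S /\ h v x by rewrite inE => /andP.
have XP x : x \in X -> x = v \/ x \in S /\ exists2 p, p \in N1 & h p x.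
  rewrite !inE => /orP[/eqP|/andP[xS /existsP[p /andP[pN hp]]]]; first by left.
  by right; split=> //; exists p.
have XI p x : x \in S -> p \in N1 -> h p x -> x \in X.
  move=> xS pN hp; rewrite in_setU1 [X in _ || X]inE xS.
  by apply/orP; right; apply/existsP; exists p; rewrite pN.
have vX : v \in X by rewrite setU11.
have nvX x : x \in X -> ~~ h v x.
  case/XP=> [->|[_ [p /N1P[_ hvp] hpx]]].
    by apply/negP=> hvv; apply: (h_triangle_free hvv hvv).
  by rewrite h_sym in hpx; apply: tri hvp hpx.
have N3P x : x \in N3 -> [/\ x \in S, x \notin X, x \notin N1 &
    exists p q, [/\ p \in X, q \in N1, h v q, h q p & h p x]].
  rewrite inE in_setD in_setU negb_or.
  case/andP=> /andP[/andP[nX nN] xS] /existsP[p /andP[pX hpx]]; split=> //.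
  case: (XP _ pX) => [E|[_ [q qN hqp]]].
    by case/negP: nN; rewrite inE xS -E.
  by exists p, q; split=> //; case: (N1P _ qN).
have N3I p x : x \in S -> x \notin X -> x \notin N1 -> p \in X -> h p x ->
    x \in N3.
  move=> xS nX nN pX hpx; rewrite inE in_setD in_setU negb_or nX nN xS.
  by apply/existsP; exists p; rewrite pX.
have N1I x : x \in S -> h v x -> x \in N1 by move=> xS hx; rewrite inE xS.
clearbody N3 X N1.
have XS x : x \in X -> x \in S by case/XP=> [->|[]].
(* two steps out of level two would end an induced P5 starting at v *)
have noP5 x y : x \in N3 -> y \in S -> y \notin X -> y \notin N1 -> ~~ h x y.
  case/N3P=> xS nX nN [p [q [pX qN hvq hqp hpx]]] yS nyX nyN; apply/negP=> hxy.
  case/or3P: (h_P5_free hvq hqp hpx hxy) => H.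
  - by case/negP: nN; apply: N1I.
  - by case/negP: nyN; apply: N1I.
  - by case/negP: nyX; apply: XI H.
(* An edge inside level two closes a pentagon through [v] and the two predecessors. *)
have stX : {in X &, forall x y, ~~ h x y}.
  move=> x y xX yX; apply/negP=> hxy.
  case: (XP _ xX) => [E|[xS [p pN hpx]]].
    by move: hxy; rewrite E; apply/negP/nvX.
  case: (XP _ yX) => [E|[yS [q qN hqy]]].
    by move: hxy; rewrite h_sym E; apply/negP/nvX.
  case: (N1P _ pN) (N1P _ qN) => pS hvp [qS hvq].
  by case/and5P: (noC5 p x y q); split=> //; rewrite h_sym.
have stY : {in Y &, forall x y, ~~ h x y}.
  move=> x y; rewrite !in_setU => /orP[] xY /orP[] yY.
  - case: (N1P _ xY) (N1P _ yY) => _ hx [_ hy].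
    by rewrite h_sym in hx; rewrite h_sym in hy; apply: tri hx hy.
  - by case: (N3P _ yY) => yS nX _ _; apply: contra nX => hxy; apply: XI hxy.
  - rewrite h_sym.
    by case: (N3P _ xY) => yS nX _ _; apply: contra nX => hxy; apply: XI hxy.
  - by case: (N3P _ yY) => yS nX nN _; apply: noP5.
exists (X :|: Y); split.
- by rewrite in_setU vX.
- apply/subsetP=> x; rewrite !in_setU.
  by case/or3P=> [xX|/N1P[]|/N3P[]] //; apply: XS.
- move=> x y; rewrite in_setD !in_setU => xU /andP[].
  rewrite !negb_or => /and3P[nyX nyN nyN3] yS.
  case/or3P: xU => xU.
  + by apply: contra nyN3; apply: N3I.
  + by apply: contra nyX; apply: XI.
  + exact: noP5.
- have cXY := cardsU X Y; have [leXY|/ltnW leYX] := leqP #|X| #|Y|.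
    by apply: (@half_mated_stable _ Y); rewrite ?subsetUr //; lia.
  by apply: (@half_mated_stable _ X); rewrite ?subsetUl //; lia.
Qed.

(** Strong induction on [#|S|], splitting off a part closed under [h]-neighbours: a hull if [v] lies
    on a pentagon, the levels of [v] otherwise. *)
Lemma half_mated_all (S : {set V}) : half_mated S.
Proof.
have [n leSn] := ubnP #|S|; elim: n S leSn => // n IHn S leSn.
have [->|[v vS]] := set_0Vmem S.
  by apply: (@half_mated_stable _ set0); rewrite ?cards0 // => x y; rewrite inE.
suff [U [vU sUS sepU mU]] : exists U : {set V}, [/\ v \in U, U \subset S,
    {in U & S :\: U, forall x y, ~~ h x y} & half_mated U].
  apply: (half_mated_join sUS sepU mU); apply: IHn.
  apply: leq_trans (_ : #|S| <= n); last by [].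
  rewrite proper_card // properEneq subsetDl andbT.
  by apply/eqP=> /setP/(_ v); rewrite in_setD vU vS.
case: (boolP [exists p : V * V * V * V, pentagon v p.1.1.1 p.1.1.2 p.1.2 p.2]).
  case/existsP=> [[[[b c] d] e]] /= pent.
  exists (pentagon_hull S v b c d e); split.
  - case/and5P: pent => hvb _ _ _ hev.
    by rewrite !inE vS hev (h_sym b) hvb.
  - by apply/subsetP=> x; rewrite !inE; case: (x \in S).
  - move=> x y xH; rewrite in_setD => /andP[nyH yS].
    by apply: contra nyH; apply: pentagon_hull_closed.
  - exact: half_mated_pentagon.
move/existsPn=> noC5; apply: half_mated_levels => // a b c d.
exact: (noC5 (a, b, c, d)).
Qed.

End Mates.

(** * The complement of a house-free graph *)

Lemma contains_induced_inj (G K : sgraph) (g : K -> G) :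
  injective g -> (forall x y, edge (g x) (g y) = edge x y) ->
  contains_induced G K.
Proof.
move=> g_inj gE; pose S := [set g x | x : K]; exists S.
have gS x : g x \in S by apply: imset_f.
pose g' x : induced S := exist _ (g x) (gS x).
have g'_inj : injective g' by move=> x y [/g_inj].
(* [isomorphic] asks for a map out of the induced subgraph, hence the inverse of [g'], which exists
   by counting. *)
have [|f gK fK] := inj_card_bij g'_inj.
  by rewrite card_sig -(card_imset _ g_inj) subset_leq_card // subset_predT.
exists f; first by exists g'.
by move=> x y; rewrite -{2}(fK x) -{2}(fK y) -gE.
Qed.

Section Complement.

Variable G : sgraph.

Definition non_edge : rel G := fun x y => (x != y) && ~~ edge x y.

Lemma non_edge_sym : symmetric non_edge.
Proof. by move=> x y; rewrite /non_edge eq_sym edge_sym. Qed.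

Lemma alpha2_non_edge (x y z : G) :
  alpha G <= 2 -> non_edge x y -> non_edge y z -> non_edge x z -> False.
Proof.
move=> le2 /andP[dxy nxy] /andP[dyz nyz] /andP[dxz nxz].
have st : stable [set x; y; z].
  apply/forall_inP=> u uS; apply/forall_inP=> w wS; move: uS wS.
  rewrite !inE -!orbA => /or3P[]/eqP-> /or3P[]/eqP->;
  by rewrite ?edge_irr // edge_sym.
have : 3 <= alpha G.
  apply: leq_trans (leq_bigmax_cond _ st).
  by rewrite setUC cardsU1 cards2 !inE negb_or dxy !(eq_sym z) dxz dyz.
by lia.
Qed.

(** The chords [a c], [b d] and [c e] are excluded by [alpha G <= 2], so otherwise [a b c d e] would
    be an induced path in the complement, that is, a house in [G]. *)
Lemma house_free_non_edge (a b c d e : G) :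
  alpha G <= 2 -> ~ contains_induced G house ->
  non_edge a b -> non_edge b c -> non_edge c d -> non_edge d e ->
  [|| non_edge a d, non_edge a e | non_edge b e].
Proof.
move=> le2 nohouse hab hbc hcd hde; apply/negPn/negP.
rewrite !negb_or => /and3P[nad nae nbe]; apply: nohouse.
have tri x y z : non_edge x z -> non_edge z y -> ~~ non_edge x y.
  by move=> hxz hzy; apply/negP; apply: alpha2_non_edge hxz hzy.
have nac := tri _ _ _ hab hbc; have nbd := tri _ _ _ hbc hcd.
have nce := tri _ _ _ hcd hde.
(* Non-consecutive vertices are told apart by a vertex that is [non_edge]-related to exactly one of
   them. *)
have dis x y z : non_edge x z -> ~~ non_edge y z -> x != y.
  by move=> hxz; apply: contraNneq => <-.
have symN x y : ~~ non_edge x y -> ~~ non_edge y x by rewrite non_edge_sym.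
have sym x y : non_edge x y -> non_edge y x by rewrite non_edge_sym.
have dac : c != a by apply: dis hcd nad.
have dad : d != a by apply: dis hde nae.
have dae : e != a by apply: dis (sym _ _ hde) nad.
have dbd : d != b by apply: dis hde nbe.
have dbe : b != e by apply: dis (sym _ _ hab) (symN _ _ nae).
have dce : c != e by apply: dis (sym _ _ hbc) (symN _ _ nbe).
have adj x y : x != y -> ~~ non_edge x y -> edge x y.
  by rewrite /non_edge => ->; rewrite negbK.
have nadj x y : non_edge x y -> edge x y = false by case/andP=> _ /negbTE.
(* the vertices 0, 2, 4, 3, 1 of the house induce a path in its complement *)
apply: (@contains_induced_inj G house (fun i => nth a [:: a; e; b; d; c] i)).
  move=> i j /eqP; rewrite nth_uniq //; first by move/eqP/val_inj.
  have [/andP[dab _] /andP[dbc _]] := (hab, hbc).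
  have [/andP[dcd _] /andP[dde _]] := (hcd, hde).
  rewrite /= !inE !negb_or (eq_sym a e) dae dab (eq_sym a d) dad (eq_sym a c) dac.
  rewrite (eq_sym e b) dbe (eq_sym e d) dde (eq_sym e c) dce (eq_sym b d) dbd dbc.
  by rewrite (eq_sym d c) dcd.
have eS := @edge_sym G.
have [ab bc] := (nadj _ _ hab, nadj _ _ hbc).
have [cd de] := (nadj _ _ hcd, nadj _ _ hde).
have ac := adj _ _ dac (symN _ _ nac); have ad := adj _ _ dad (symN _ _ nad).
have ae := adj _ _ dae (symN _ _ nae); have bd := adj _ _ dbd (symN _ _ nbd).
have be := adj _ _ dbe nbe; have ce := adj _ _ dce nce.
case=> [[|[|[|[|[|i]]]]] Hi] [[|[|[|[|[|j]]]]] Hj] //=;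
by rewrite ?edge_irr // ?ab ?bc ?cd ?de ?ac ?ad ?ae ?bd ?be ?ce //
     eS ?ab ?bc ?cd ?de ?ac ?ad ?ae ?bd ?be ?ce.
Qed.

(** * From a mated set to an immersion *)

Lemma mated_immersion (B : {set G}) (m : G -> G) (n : nat) :
  mated non_edge [set: G] B m -> n <= #|B| ->
  contains_immersion G (complete n).
Proof.
move=> [_ mB m_inj] lenB.
pose phi (i : complete n) : G := enum_val (widen_ord lenB i).
have phi_inj : injective phi.
  by move=> i j /enum_val_inj/(congr1 val) /= /val_inj.
have phiB i : phi i \in B by apply: enum_valP.
pose pth x y := if edge x y then [:: x; y] else [:: x; m y; m x; y].
(* [enum] fixes an order of the two ends; the empty list never occurs on an edge. *)
pose P (A : {set complete n}) :=
  if enum A is [:: u; v] then pth (phi u) (phi v) else [::].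
have PE A : A \in edges (complete n) ->
    exists u v, [/\ u != v, A = [set u; v] & P A = pth (phi u) (phi v)].
  case/imsetP=> [[u v]]; rewrite inE /= => duv AE; rewrite /P.
  have := cards2 u v; rewrite -AE (duv : u != v) cardE.
  have := enum_uniq A; have := mem_enum A.
  case: (enum A) => [|u' [|v' []]] //= memA; rewrite inE andbT => d _.
  by exists u', v'; split=> //; apply/setP=> x; rewrite -memA !inE.
have non_edgeN x y : x != y -> edge x y = false -> non_edge x y.
  by rewrite /non_edge => -> ->.
(* The ends are exchanged for the last edge, from [m x] to [y], so two shapes with mates suffice. *)
have pthE x y E : x \in B -> y \in B -> x != y -> E \in path_edges (pth x y) ->
    exists a b, [/\ [set a; b] = [set x; y], a \in B, b \in B &
      E = [set a; b] \/ non_edge a b /\ (E = [set a; m b] \/ E = [set m a; m b])].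
  move=> xB yB dxy; rewrite /pth; case: ifP => [_|/(non_edgeN _ _ dxy) hxy].
    by rewrite !inE /= => /eqP->; exists x, y; split=> //; left.
  rewrite !inE /= => /or3P[]/eqP->.
  - by exists x, y; split=> //; right; split=> //; left.
  - by exists x, y; split=> //; right; split=> //; right; rewrite setUC.
  - exists y, x; rewrite setUC; split=> //; right; rewrite non_edge_sym.
    by split=> //; left; rewrite setUC.
have mnB a b : a \in B -> b \in B -> non_edge a b ->
    (m a \in B = false) * (m b \in B = false).
  move=> aB bB hab; have hba : non_edge b a by rewrite non_edge_sym.
  have [+ _ _] := mB _ _ aB bB hab; have [+ _ _] := mB _ _ bB aB hba.
  by rewrite !inE !andbT => /negbTE-> /negbTE->.
(* Mates lie outside [B], so membership in [B] reveals the shape of [E], and injectivity of [m]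
   recovers the pair. *)
have decode a b a' b' E : a \in B -> b \in B -> a' \in B -> b' \in B ->
    E = [set a; b] \/ non_edge a b /\ (E = [set a; m b] \/ E = [set m a; m b]) ->
    E = [set a'; b'] \/ non_edge a' b' /\ (E = [set a'; m b'] \/ E = [set m a'; m b']) ->
    [set a; b] = [set a'; b'].
  move=> aB bB a'B b'B.
  case=> [->|[hab Eab]] [EE|[hab' Eab']] //.
  - have [na' nb'] := mnB _ _ a'B b'B hab'.
    by case: Eab' => /set2_eq[] [E1 E2]; rewrite -?E1 -?E2 ?aB ?bB in na' nb'.
  - have [na nb] := mnB _ _ aB bB hab.
    by case: Eab; rewrite EE => /set2_eq[] [E1 E2]; rewrite -?E1 -?E2 ?a'B ?b'B in na nb.
  have [na nb] := mnB _ _ aB bB hab; have [na' nb'] := mnB _ _ a'B b'B hab'.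
  have hba : non_edge b a by rewrite non_edge_sym.
  have hba' : non_edge b' a' by rewrite non_edge_sym.
  case: Eab Eab' => -> [] /set2_eq[] [E1 E2].
  - by rewrite E1 (m_inj _ _ _ _ bB aB b'B a'B hba hba' E2).
  - by rewrite -E1 aB in nb'.
  - by rewrite -E1 aB in na'.
  - by rewrite -E1 aB in nb'.
  - by rewrite E1 a'B in na.
  - by rewrite E2 a'B in nb.
  - by rewrite (m_inj _ _ _ _ aB bB a'B b'B hab hab' E1)
               (m_inj _ _ _ _ bB aB b'B a'B hba hba' E2).
  - by rewrite (m_inj _ _ _ _ aB bB b'B a'B hab hba' E1)
               (m_inj _ _ _ _ bB aB a'B b'B hba hab' E2) setUC.
have imB u v : [set phi u; phi v] = phi @: [set u; v] by rewrite imsetU1 imset_set1.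
exists phi, P; split=> //.
- move=> u v duv; have Auv : [set u; v] \in edges (complete n).
    by apply/imsetP; exists (u, v).
  have pb x y : x \in B -> y \in B -> x != y -> path_between x y (pth x y).
    move=> xB yB dxy; rewrite /pth; case: ifP => [exy|/(non_edgeN _ _ dxy) hxy].
      by exists [:: y]; split=> //=; rewrite ?exy // inE dxy.
    have hyx : non_edge y x by rewrite non_edge_sym.
    have [nx ny] := mnB _ _ xB yB hxy.
    have [_ nxmy nmm] := mB _ _ xB yB hxy; have [_ nymx _] := mB _ _ yB xB hyx.
    (* [~~ non_edge] also allows equality; distinctness turns it into adjacency. *)
    have dxmy : x != m y by apply: contraFneq ny => <-.
    have dxmx : x != m x by apply: contraFneq nx => <-.
    have dymx : y != m x by apply: contraFneq nx => <-.
    have dymy : y != m y by apply: contraFneq ny => <-.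
    have dmm : m x != m y.
      by apply: contraTneq dxy => E; rewrite (m_inj _ _ _ _ xB yB yB xB hxy hyx E) eqxx.
    exists [:: m y; m x; y]; split=> //=.
      move: nxmy nymx nmm; rewrite /non_edge dxmy dymx dmm /= !negbK => -> exy emm.
      by rewrite edge_sym emm edge_sym exy.
    by rewrite !inE !negb_or dxmy dxmx dxy (eq_sym (m y)) dmm !(eq_sym _ y) dymy dymx.
  have [u' [v' [duv' E ->]]] := PE _ Auv.
  by case: (set2_eq E) => -[-> ->]; [left | right]; apply: pb => //;
     rewrite (inj_eq phi_inj).
- move=> A A' /PE[u [v [duv AE ->]]] /PE[u' [v' [duv' AE' ->]]] dAA'.
  apply/pred0P=> E /=; apply/negP=> /andP[EP EP'].
  have phiD w w' : w != w' -> phi w != phi w' by rewrite (inj_eq phi_inj).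
  have [a [b [ab aB bB Eab]]] := pthE _ _ _ (phiB u) (phiB v) (phiD _ _ duv) EP.
  have [a' [b' [ab' a'B b'B Eab']]] := pthE _ _ _ (phiB u') (phiB v') (phiD _ _ duv') EP'.
  case/eqP: dAA'; apply: (imset_inj phi_inj); rewrite AE AE' -!imB -ab -ab'.
  exact: decode Eab Eab'.
- move=> A w /PE[u [v [duv AE ->]]]; rewrite /pth; case: ifP => [//|].
  rewrite -(inj_eq phi_inj) in duv => /(non_edgeN _ _ duv) huv.
  have [nu nv] := mnB _ _ (phiB u) (phiB v) huv.
  rewrite /interior /= !inE negb_or; apply/andP.
  by split; [apply: contraFneq nv | apply: contraFneq nu] => <-.
Qed.

End Complement.

Theorem theorem3p2 (G : sgraph) (halpha : alpha G <= 2)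
    (hhouse : ~ contains_induced G house) :
  contains_immersion G (complete (uphalf #|G|)).
Proof.
have [|a b c d e|B [m [mB leB]]] := @half_mated_all _ _ (@non_edge_sym G) _ _ [set: G].
- by move=> x y z; apply: alpha2_non_edge.
- exact: house_free_non_edge.
- by apply: mated_immersion mB _; rewrite cardsT in leB; lia.
Qed.
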